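(* Let $J=(a_1,\dots,a_5)$ be positive integers, $K=C_5(J)$ with vertex set $\{i_1,\dots,i_{a_i}:i\in\mathbb{Z}_5\}$, and $N=a_1+\dots+a_5$. Let \[A_3=\begin{pmatrix}1&0&1&1&0\\0&1&1&0&1\end{pmatrix},\qquad A_2=\begin{pmatrix}1&0&1&1&1\\0&1&1&0&1\end{pmatrix}\] over $\mathbb{Z}_2$. For $A\in\{A_3,A_2\}$ with columns $v_1,\dots,v_5$, put $M_i=(0\;\cdots\;0\;v_i)$ ($2\times a_i$), $S_a=(I_{a-1}\mid\mathbf 1)$ (the $(a-1)\times a$ matrix consisting of the identity followed by a column of $1$'s), and for vectors $n_1=(n_{12},\dots,n_{1a_1})^T\in\mathbb{Z}_2^{a_1-1}$, $n_4=(n_{42},\dots,n_{4a_4})^T\in\mathbb{Z}_2^{a_4-1}$ put $N_i=(0\;\cdots\;0\;n_i)$ ($(a_i-1)\times a_5$), with $n_{11}=n_{41}=0$. Let \[\Lambda=\begin{pmatrix}M_1&M_2&M_3&M_4&M_5\\ S_{a_1}&0&0&0&N_1\\0&S_{a_2}&0&0&0\\0&0&S_{a_3}&0&0\\0&0&0&S_{a_4}&N_4\\0&0&0&0&S_{a_5}\end{pmatrix}_{(N-3)\times N}\] with column blocks corresponding to $i_1,\dots,i_{a_i}$. Then, up to rotational symmetry of the pentagon and basis change, every small cover over $P_5(a_1,\dots,a_5)$ (i.e. every non-singular characteristic map over $\mathbb{Z}_2$ on $K$) is given by such a $\Lambda$, for an arbitrary choice of $A$, $n_1$, $n_4$. The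 projection of $\Lambda$ over the pentagon labeled $(b_1,\dots,b_5)$ has type $3$ if ($A=A_3$ and $n_{1b_1}+n_{4b_4}=0$) or ($A=A_2$ and $n_{1b_1}+n_{4b_4}=1$), and type $2$ if ($A=A_3$ and $n_{1b_1}+n_{4b_4}=1$) or ($A=A_2$ and $n_{1b_1}+n_{4b_4}=0$). Consequently the number of Davis–Januszkiewicz classes of small covers over $P_5(a_1,\dots,a_5)$ is \[2^{a_1+a_4-1}+2^{a_2+a_5-1}+2^{a_3+a_1-1}+2^{a_4+a_2-1}+2^{a_5+a_3-1}-5.\]
   Context: $C_5$ is the simplicial complex on $\mathbb{Z}_5$ with maximal faces $\{i,i+1\}$; $C_5(J)$ is the complex on vertices $i_1,\dots,i_{a_i}$ whose minimal non-faces are $\{i_1,\dots,i_{a_i},j_1,\dots,j_{a_j}\}$ for $j-i=\pm 2$; it is the boundary complex of the dual of the simple polytope $P_5(a_1,\dots,a_5)$. A characteristic map over $\mathbb{Z}_2$ on $K$ of dimension $N-3$ is $\lambda:V(K)\to\mathbb{Z}_2^{N-3}$, non-singular if the vectors on each face are linearly independent over $\mathbb{Z}_2$; small covers over the polytope correspond to such maps, and two are Davis–Januszkiewicz equivalent if they differ by an element of $GL_{N-3}(\mathbb{Z}_2)$. The pentagon labeled $(b_1,\dots,b_5)$ ($1\le b_i\le a_i$) is $\operatorname{link}_K\sigma$, $\sigma=\{i_j:j\ne b_i\}$, identified with $C_5$ via $i_{b_i}\mapsto i$, and the projection of $\Lambda$ over it is $w\mapsto[\Lambda(w)]$ in the quotient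 of $\mathbb{Z}_2^{N-3}$ by the span of $\Lambda(\sigma)$. Every non-singular $\mathbb{Z}_2$-characteristic map on $C_5$ is, up to $GL_2(\mathbb{Z}_2)$, of the form (columns on vertices $1,\dots,5$) equal to $(a\,b\,a\,b\,c)$ up to cyclic rotation, for distinct nonzero $a,b,c\in\mathbb{Z}_2^2$; its type is the position of $c$ (so $A_2$ has type 2 and $A_3$ has type 3).
   Formalization: The indexing of n_1 and n_4 is corrected to fit the displayed matrix: n_{1b}, n_{4b} denote the entry in the row whose identity column is vertex 1_b, 4_b (b<a_i), and the value 0 belongs to the last vertex (n_{1a_1}=n_{4a_4}=0) instead of n_{11}=n_{41}=0. *)

(* Defs.v *)
From HB Require Import structures.
From mathcomp Require Import all_boot all_order all_algebra.
Set Implicit Arguments. Unset Strict Implicit. Unset Printing Implicit Defensive.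
Import GRing.Theory.
Local Open Scope ring_scope.

(* Conventions: the classes of Z_5 = {1,..,5} of the paper are indexed by
   i : 'I_5 with paper-label i+1 (so the paper's 5 is 4 here; differences
   mod 5 are preserved).  Inside class i the vertices i_1,...,i_{a_i} are
   k : 'I_(a i) with i_{k+1} <-> k; the last one (k = a_i - 1) is the
   "special" vertex (the column carrying v_i in the block matrix Lambda). *)

Section Defs.
Variable a : 'I_5 -> nat.

Definition vert := {i : 'I_5 & 'I_(a i)}.

Definition cls (i : 'I_5) : {set vert} := [set v : vert | tag v == i].

Definition nonadj (i j : 'I_5) : bool :=
  (j == inord ((i + 2) %% 5) :> 'I_5) || (i == inord ((j + 2) %% 5) :> 'I_5).

(* faces of C_5(J): subsets containing no minimal non-face
   {i_1..i_{a_i}, j_1..j_{a_j}} with j - i = +-2 *)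
Definition isFace (s : {set vert}) : bool :=
  [forall i : 'I_5, forall j : 'I_5,
     nonadj i j ==> ~~ ((cls i \subset s) && (cls j \subset s))].

Variable n : nat.

Definition nonsing (lam : vert -> 'rV['F_2]_n) : bool :=
  [forall s : {set vert}, isFace s ==> free [seq lam v | v <- enum s]].

Definition dj (lam mu : vert -> 'rV['F_2]_n) : bool :=
  [exists g : 'M['F_2]_n, (g \in unitmx) && [forall v, mu v == lam v *m g]].

Definition num_dj_classes : nat :=
  #|[set [set mu : {ffun vert -> 'rV['F_2]_n} | dj (lam : {ffun vert -> 'rV['F_2]_n}) mu]
     | lam in [set lam : {ffun vert -> 'rV['F_2]_n} | nonsing lam]]|.

(* Projection over the pentagon labeled b (b i : 'I_(a i) is the vertex
   i_{b_i}).  sigma = {i_j : j <> b_i}; the projected map sends i to the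
   class of lam (i_{b_i}) in Z_2^n / span(lam sigma).  Equality (resp.
   vanishing) in the quotient is membership of the difference (resp. of the
   vector) in the span. *)
Definition pent_vertex (b : forall i : 'I_5, 'I_(a i)) (i : 'I_5) : vert :=
  existT _ i (b i).

Definition link_span (lam : vert -> 'rV['F_2]_n) (b : forall i : 'I_5, 'I_(a i))
  : {vspace 'rV['F_2]_n} :=
  <<[seq lam v | v <- enum [set v : vert | tagged v != b (tag v)]]>>%VS.

Definition proj_eq lam b (i j : 'I_5) : bool :=
  (lam (pent_vertex b i) - lam (pent_vertex b j)) \in link_span lam b.

Definition proj_nz lam b (i : 'I_5) : bool :=
  lam (pent_vertex b i) \notin link_span lam b.

(* The projection has type t: it is of the form (a b a b c) up to cyclic
   rotation, with a, b, c distinct and nonzero, and c sitting at vertex t. *)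
Definition proj_type lam b (t : 'I_5) : Prop :=
  let s (k : nat) : 'I_5 := inord ((t + k) %% 5) in
  [/\ proj_eq lam b (s 1%N) (s 3%N), proj_eq lam b (s 2%N) (s 4%N),
      ~~ proj_eq lam b (s 1%N) (s 2%N),
      ~~ proj_eq lam b t (s 1%N) & ~~ proj_eq lam b t (s 2%N)]
  /\ [/\ proj_nz lam b t, proj_nz lam b (s 1%N) & proj_nz lam b (s 2%N)].

Inductive Achoice := A3 | A2.

(* entry (t, j) of A (t < 2, role j < 5, role j <-> paper column j+1) *)
Definition Aentry (A : Achoice) (t j : nat) : 'F_2 :=
  if t == 0%N then
    (nth false [:: true; false; true; true; if A is A3 then false else true] j)%:R
  else (nth false [:: false; true; true; false; true] j)%:R.

(* the standard basis row vector e_m of Z_2^n (zero if m >= n) *)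
Definition unitv (m : nat) : 'rV['F_2]_n := \row_(p < n) (p == m :> nat)%N%:R.

(* row coordinates: rows 0,1 are the top (A) rows; block i of S_{a_i}
   occupies rows 2 + off i, ..., 2 + off i + a_i - 2 *)
Definition off (i : 'I_5) : nat := (\sum_(j < 5 | j < i) (a j).-1)%N.

(* Lambda, with a rotation r of the pentagon built in: class i plays the
   role (i - r) mod 5 of the paper's normal form.  Rotation r = 0 is
   exactly the paper's matrix; for general r, the roles of the paper's
   classes 1, 4, 5 are played by r, r+3, r+4, and the rows are kept in the
   order of the original classes (a basis change).  n1, n4 give the entries
   of the vectors n_1, n_4: n1 k is the entry in the row of vertex k of the
   role-1 class (k < a - 1); the special vertex gets the value 0. *)
Definition role (r i : 'I_5) : 'I_5 := inord ((i + 5 - r) %% 5).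
Definition rcls (r : 'I_5) (j : nat) : 'I_5 := inord ((r + j) %% 5).

Definition Lam (r : 'I_5) (A : Achoice) (n1 n4 : nat -> 'F_2) (v : vert)
  : 'rV['F_2]_n :=
  let i := tag v in let k := val (tagged v) in
  if (k < (a i).-1)%N then unitv (2 + off i + k)
  else
    Aentry A 0 (role r i) *: unitv 0 + Aentry A 1 (role r i) *: unitv 1
    + \sum_(q < (a i).-1) unitv (2 + off i + q)
    + (if (role r i == 4 :> nat)%N then
         \sum_(q < (a (rcls r 0)).-1) n1 q *: unitv (2 + off (rcls r 0) + q)
       + \sum_(q < (a (rcls r 3)).-1) n4 q *: unitv (2 + off (rcls r 3) + q)
       else 0).

End Defs.

Definition neff (a : 'I_5 -> nat) (c : 'I_5) (m : nat -> 'F_2) (k : nat) : 'F_2 :=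
  if (k < (a c).-1)%N then m k else 0.

(* Main.v *)
(* Gale duality.  A non-singular map is determined up to GL by its space of
   linear relations, which has dimension N - n = 3; evaluating relations at the
   vertices turns it into a map g from the vertices to Z_2^3.  Complements of
   facets are triples of vertices in three consecutive classes, so the map is
   non-singular iff g is independent on all such triples.  Normalise g to be
   the standard basis at the special vertices of the first three classes.  Then
   the special vertices form one of five pentagons, of type t when
     g_t = g_{t+1} + g_{t+3} = g_{t+2} + g_{t+4}.
   A vertex of class t+1 or t+3 (resp. t+2 or t+4) may only deviate from the
   special vertex of its class by g_{t+2} (resp. g_{t+3}), and deviations of the
   two kinds exclude each other.  Hence classes correspond to pairs (t, D) with
   D a set of deviating vertices of one kind; Lambda for rotation r realises
   t = r+2 (for A3) or t = r+1 (for A2) with D read off from n_1 and n_4.  The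
   number of pairs is the sum over t of 2^|classes t+1,t+3| + 2^|classes t+2,t+4|
   - 1, where only non-special vertices are counted. *)
Require Import Defs.
From HB Require Import structures.
From mathcomp Require Import all_boot all_order all_algebra.
From mathcomp Require Import zify.
Set Implicit Arguments. Unset Strict Implicit. Unset Printing Implicit Defensive.
Import GRing.Theory.
Local Open Scope ring_scope.

Lemma natrF2_addb (b c : bool) : (b (+) c)%:R = b%:R + c%:R :> 'F_2.
Proof. by case: b; case: c; apply/eqP. Qed.

Lemma natrF2_neq0 (x : 'F_2) : (x != 0)%:R = x.
Proof. by case: x => [[|[|m]] ltm] //; apply/eqP. Qed.

Lemma natrF2_inj (b c : bool) : b%:R = c%:R :> 'F_2 -> b = c.
Proof. by case: b; case: c. Qed.

(** * Relations of a vector configuration over Z_2 *)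

Section Relations.
Variables (V : finType) (n : nat).
Implicit Types (lam mu : V -> 'rV['F_2]_n) (c d : V -> bool) (S : {set V}).

(** Coefficients are Booleans, so that a relation is a predicate on [V] and relations add by
    pointwise [(+)]. *)
Definition comb lam c := \sum_v (c v)%:R *: lam v.

Lemma eq_comb lam c d : c =1 d -> comb lam c = comb lam d.
Proof. by move=> eq_cd; apply: eq_bigr => v _; rewrite eq_cd. Qed.

Lemma comb_addb lam c d :
  comb lam (fun v => c v (+) d v) = comb lam c + comb lam d.
Proof. by rewrite -big_split; apply: eq_bigr => v _; rewrite natrF2_addb scalerDl. Qed.

Lemma comb_andb lam (e : bool) c :
  comb lam (fun v => e && c v) = e%:R *: comb lam c.
Proof.
rewrite /comb scaler_sumr; apply: eq_bigr => v _.
by case: e; rewrite ?scale1r ?scale0r.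
Qed.

Lemma comb_pred1 lam x : comb lam (pred1 x) = lam x.
Proof.
rewrite /comb (bigD1 x) //= eqxx scale1r big1 ?addr0 // => v /negPf ->.
by rewrite scale0r.
Qed.

Lemma F2_addvv (w : 'rV['F_2]_n) : w + w = 0.
Proof.
rewrite -mulr2n -scaler_nat; have -> : 2%:R = 0 :> 'F_2 by apply/eqP.
exact: scale0r.
Qed.

Lemma F2_oppv (w : 'rV['F_2]_n) : - w = w.
Proof. by apply/eqP; rewrite eq_sym -addr_eq0 F2_addvv. Qed.

Lemma comb_supp lam c S : (forall v, c v -> v \in S) ->
  comb lam c = \sum_(v in S) (c v)%:R *: lam v.
Proof.
move=> cS; rewrite /comb (bigID (mem S)) /= [X in _ + X]big1 ?addr0 // => v vS.
by case: (boolP (c v)) => [/cS|]; rewrite ?(negPf vS) // scale0r.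
Qed.

(** In characteristic 2, the coefficients on [S] that express the vector can be added to [c0]; this
    turns [c0] into a relation and changes it only inside [S]. *)
Lemma mem_span_comb lam c0 S :
  reflect (exists2 c, comb lam c = 0 & forall v, v \notin S -> c v = c0 v)
          (comb lam c0 \in <<[seq lam v | v <- enum S]>>%VS).
Proof.
rewrite span_def big_map big_enum /=.
apply: (iffP memv_sumP) => [[vs vsP def]|[c rel_c eqc]].
  have vsE v : v \in S -> vs v = ((v \in S) && (vs v != 0))%:R *: lam v.
    move=> vS; have /vlineP[k ->] := vsP v vS; rewrite vS /=.
    case: (eqVneq k 0) => [->|]; first by rewrite !scale0r eqxx scale0r.
    move: k => [[|[|m]] ltm] //= _; have -> : Ordinal ltm = 1 by apply/eqP.
    by rewrite !scale1r; case: eqVneq => [->|]; rewrite ?scale0r ?scale1r.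
  exists (fun v => c0 v (+) ((v \in S) && (vs v != 0))); last first.
    by move=> v /negPf ->; rewrite addbF.
  rewrite comb_addb [X in _ + X](@comb_supp _ _ S) => [|v /=]; last by case/andP.
  by rewrite def (eq_bigr _ vsE) F2_addvv.
exists (fun v => (c0 v (+) c v)%:R *: lam v) => [v _|].
  exact: memvZ (memv_line _).
rewrite -(@comb_supp _ _ S); first by rewrite comb_addb rel_c addr0.
by move=> v; apply: contraTT => /eqc ->; rewrite addbb.
Qed.

Lemma free_combP lam S :
  reflect (forall c, comb lam c = 0 -> (forall v, c v -> v \in S) -> c =1 xpred0)
          (free [seq lam v | v <- enum S]).
Proof.
apply: (iffP (@freeP _ _ _ (image_tuple lam (mem S)))) => [fr c rel_c cS v|fr k sum0 i].
  apply/negP => cv; have vS := cS v cv.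
  have /fr/(_ (enum_rank_in vS v)) : \sum_(i < #|S|)
      (c (enum_val i))%:R *: (image_tuple lam (mem S))`_i = 0.
    rewrite -[RHS]rel_c (@comb_supp _ _ S cS) [RHS]big_enum_val /=.
    by apply: eq_bigr => i _; rewrite nth_image.
  by rewrite enum_rankK_in // cv.
pose c v := [exists j : 'I_#|S|, (enum_val j == v) && (k j != 0)].
have cE j : c (enum_val j) = (k j != 0).
  apply/existsP/idP => [[j' /andP[/eqP/enum_val_inj -> //]]|kj].
  by exists j; rewrite eqxx.
have cS v : c v -> v \in S.
  by case/existsP=> j /andP[/eqP <- _]; exact: enum_valP.
apply/eqP; rewrite -[_ == _]negbK -cE fr // (comb_supp _ cS) [LHS]big_enum_val /=.
rewrite -[RHS]sum0; apply: eq_bigr => j _.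
by rewrite cE natrF2_neq0 nth_image.
Qed.

Definition relmx lam : 'M['F_2]_(#|V|, n) := \matrix_i lam (enum_val i).

Lemma mul_relmx lam (u : 'rV['F_2]_#|V|) :
  u *m relmx lam = comb lam (fun v => u 0 (enum_rank v) != 0).
Proof.
rewrite mulmx_sum_row /comb (reindex_onto enum_rank enum_val) /=; last first.
  by move=> i _; exact: enum_valK.
apply: eq_big => v; first by rewrite enum_rankK eqxx.
by rewrite natrF2_neq0 rowK enum_rankK.
Qed.

(* Relations of lam are the row kernel of relmx lam, i.e. the transposed cokernel
   of its transpose, so inclusion of relations is inclusion of column spaces. *)
Lemma rel_factor lam mu : (forall c, comb lam c = 0 -> comb mu c = 0) ->
  exists g : 'M['F_2]_n, relmx mu = relmx lam *m g.
Proof.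
move=> sub; have : ((relmx mu)^T <= (relmx lam)^T)%MS.
  rewrite submxE; apply/eqP/trmx_inj; rewrite trmx_mul trmxK trmx0.
  apply/row_matrixP => i; rewrite row_mul mul_relmx row0 sub // -mul_relmx -row_mul.
  have : ((cokermx (relmx lam)^T)^T *m relmx lam)^T = 0.
    by rewrite trmx_mul trmxK mulmx_coker.
  by move/(congr1 trmx); rewrite trmxK trmx0 => ->; rewrite row0.
case/submxP=> g /(congr1 trmx); rewrite trmx_mul !trmxK => def.
by exists g^T.
Qed.

(** Equal relations give factorisations [g] and [h] in both directions; spanning gives [relmx lam] a
    left inverse, which cancels to [g *m h = 1]. *)
Lemma rel_change_basis lam mu : <<[seq lam v | v <- enum [set: V]]>>%VS = fullv ->
  (forall c, comb lam c = 0 <-> comb mu c = 0) ->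
  exists2 g : 'M['F_2]_n, g \in unitmx & forall v, mu v = lam v *m g.
Proof.
move=> span_lam rels.
have [|g def_mu] := @rel_factor lam mu; first by move=> c /rels.
have [|h def_lam] := @rel_factor mu lam; first by move=> c /rels.
have full : row_full (relmx lam).
  rewrite -sub1mx; apply/row_subP => i.
  have : row i (1%:M : 'M['F_2]_n) \in fullv by exact: memvf.
  rewrite -span_lam span_def big_map big_enum /=.
  move/memv_sumP=> [vs vsP ->]; apply: summx_sub => v _.
  have /vlineP[k ->] := vsP v (in_setT v); apply: scalemx_sub.
  have -> : lam v = row (enum_rank v) (relmx lam) by rewrite rowK enum_rankK.
  exact: row_sub.
have gh1 : g *m h = 1%:M.
  have /row_fullP[B B1] := full.
  rewrite -[LHS]mul1mx -B1 -[B *m _ *m _]mulmxA [relmx lam *m _]mulmxA -def_mu.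
  by rewrite -def_lam B1.
exists g => [|v]; first by case: (mulmx1_unit gh1).
have := congr1 (row (enum_rank v)) def_mu.
by rewrite row_mul !rowK enum_rankK.
Qed.

Lemma change_basis_rel lam mu (g : 'M['F_2]_n) : g \in unitmx ->
  (forall v, mu v = lam v *m g) -> forall c, comb lam c = 0 <-> comb mu c = 0.
Proof.
move=> g_unit def_mu c; have -> : comb mu c = comb lam c *m g.
  by rewrite /comb mulmx_suml; apply: eq_bigr => v _; rewrite def_mu scalemxAl.
split=> [->|]; first by rewrite mul0mx.
by move/(congr1 (mulmx^~ (invmx g))); rewrite mulmxK // mul0mx.
Qed.

End Relations.

(** * Pentagons in Z_2^3 *)

Definition vec3 := (bool * bool * bool)%type.
Definition all3 : seq vec3 :=
  [seq (p, z) | p <- [seq (x, y) | x <- [:: true; false], y <- [:: true; false]],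
                z <- [:: true; false]].
Definition zero3 : vec3 := (false, false, false).
Definition unit3 (i : nat) : vec3 := (i == 0, i == 1, i == 2)%N.
Definition add3 (u v : vec3) : vec3 :=
  (u.1.1 (+) v.1.1, u.1.2 (+) v.1.2, u.2 (+) v.2).
Definition dot3 (u v : vec3) : bool :=
  (u.1.1 && v.1.1) (+) (u.1.2 && v.1.2) (+) (u.2 && v.2).
(** Independence tested dually: only the zero functional kills all three vectors, which is decided
    by running over eight functionals. *)
Definition indep3 (u v w : vec3) : bool :=
  all (fun al => [&& ~~ dot3 al u, ~~ dot3 al v & ~~ dot3 al w] ==> (al == zero3))
      all3.

(** Three consecutive classes are the complement of an edge of the pentagon, so this is the Gale
    dual form of non-singularity on one pentagon. *)
Definition valid5 (h : nat -> vec3) : bool :=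
  all (fun i => indep3 (h i) (h ((i + 1) %% 5)) (h ((i + 2) %% 5)))%N (iota 0 5).

(* The columns of the normalised pentagon of type t: positions 0, 1, 2 carry the
   standard basis, which together with
   g_t = g_{t+1} + g_{t+3} = g_{t+2} + g_{t+4} determines positions 3 and 4. *)
Definition base (t i : nat) : vec3 :=
  nth zero3 [:: unit3 0; unit3 1; unit3 2;
    nth zero3 [:: (true, true, false); (true, true, false); (true, false, true);
                  (true, false, true); (true, true, true)] t;
    nth zero3 [:: (true, false, true); (false, true, true); (false, true, true);
                  (true, true, true); (true, false, true)] t] i.

(** The two lists are exchanged by the reflection fixing [t]. Each consists of the two neighbours of
    the class whose vector may be added, [t+2] or [t+3] modulo 5. *)
Definition side (s : bool) (t : nat) : seq nat :=
  if s then [:: (t + 1) %% 5; (t + 3) %% 5]%N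
  else [:: (t + 4) %% 5; (t + 2) %% 5]%N.

(* zero3 is a junk value at i = t, where no deviation is possible. *)
Definition dev (t i : nat) : vec3 :=
  if i \in side true t then base t ((t + 2) %% 5)
  else if i \in side false t then base t ((t + 3) %% 5) else zero3.

Definition twist (t : nat) (d : nat -> bool) (i : nat) : vec3 :=
  if d i then add3 (base t i) (dev t i) else base t i.

Definition upd (h : nat -> vec3) (i : nat) (w : vec3) (j : nat) : vec3 :=
  if j == i then w else h j.

Lemma mem_all3 (u : vec3) : u \in all3.
Proof. by case: u => [[[] []] []]. Qed.

Lemma indep3_eq0 (u v w al : vec3) : indep3 u v w ->
  dot3 al u = false -> dot3 al v = false -> dot3 al w = false -> al = zero3.
Proof.
by move=> /allP/(_ al (mem_all3 al)) + hu hv hw; rewrite hu hv hw => /eqP.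
Qed.

Lemma indep3P (u v w : vec3) :
  (forall al, dot3 al u = false -> dot3 al v = false -> dot3 al w = false ->
    al = zero3) -> indep3 u v w.
Proof.
move=> H; apply/allP => al _; apply/implyP => /and3P[/negPf hu /negPf hv /negPf hw].
by rewrite (H al).
Qed.

(** All 64 completions of the standard basis are tested by computation. *)
Lemma valid5_type (p q : vec3) : valid5 (nth zero3 [:: unit3 0; unit3 1; unit3 2; p; q]) ->
  exists2 t, (t < 5)%N & p = base t 3 /\ q = base t 4.
Proof.
have : all (fun p => all (fun q =>
    valid5 (nth zero3 [:: unit3 0; unit3 1; unit3 2; p; q]) ==>
    has (fun t => (p == base t 3) && (q == base t 4)) (iota 0 5)) all3) all3.
  by vm_compute.
move=> /allP/(_ p (mem_all3 p))/allP/(_ q (mem_all3 q))/implyP + /[dup] _ H => /(_ H).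
by case/hasP=> t; rewrite mem_iota => /= lt_t /andP[/eqP-> /eqP->]; exists t.
Qed.

(** Meant for a pentagon that is special except at one vertex: it limits the vectors available to
    that vertex. A finite check. *)
Lemma valid5_upd (t i : nat) (w : vec3) : (t < 5)%N -> (i < 5)%N ->
  valid5 (upd (base t) i w) ->
  w = base t i \/ (w = add3 (base t i) (dev t i) /\ i \in side true t ++ side false t).
Proof.
move=> lt_t lt_i.
have : all (fun t => all (fun i => all (fun w => valid5 (upd (base t) i w) ==>
    (w == base t i) || (w == add3 (base t i) (dev t i))
                       && (i \in side true t ++ side false t)) all3) (iota 0 5)) (iota 0 5).
  by vm_compute.
move=> /allP/(_ t)/(_ _)/allP/(_ i)/(_ _)/allP/(_ w (mem_all3 w))/implyP.
rewrite !mem_iota lt_t lt_i => /(_ isT isT) + H => /(_ H).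
by case/orP=> [/eqP | /andP[/eqP]]; [left | right].
Qed.

(** Excludes deviations of both kinds: two such vertices lie in different classes, hence on a common
    pentagon. *)
Lemma valid5_sides (t i j : nat) : (t < 5)%N ->
  i \in side true t -> j \in side false t ->
  ~~ valid5 (twist t (fun k => (k == i) || (k == j))).
Proof.
move=> lt_t ti tj.
have : all (fun t => all (fun i => all (fun j =>
   ~~ valid5 (twist t (fun k => (k == i) || (k == j))))
   (side false t)) (side true t)) (iota 0 5).
  by vm_compute.
move=> /allP/(_ t)/(_ _)/allP/(_ i ti)/allP/(_ j tj); apply.
by rewrite mem_iota.
Qed.

Lemma valid5_twist (s : bool) (t : nat) (d : nat -> bool) : (t < 5)%N ->
  (forall i, d i -> i \in side s t) -> valid5 (twist t d).
Proof.
(* As a Boolean disjunction, the hypothesis survives the generalisation of the five values of [d]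
   and reduces once [t] and [s] are concrete. *)
move=> lt_t ds; have {}ds i : (i \in side s t) || ~~ d i.
  by case: (boolP (d i)) => [/ds->|_]; rewrite ?orbT.
move: (ds 0%N) (ds 1%N) (ds 2%N) (ds 3%N) (ds 4%N).
rewrite /valid5 /twist /=.
move: (d 0%N) (d 1%N) (d 2%N) (d 3%N) (d 4%N) => d0 d1 d2 d3 d4.
by move: t lt_t s {ds} => [|[|[|[|[|//]]]]] _ []; case: d0 => //; case: d1 => //;
  case: d2 => //; case: d3 => //; case: d4.
Qed.

(** * Gale duals of non-singular maps *)

Section Gale.
Variables (a : 'I_5 -> nat) (apos : forall i, (0 < a i)%N).
Notation n := (\sum_(i < 5) a i - 3)%N.
Implicit Types (lam mu : vert a -> 'rV['F_2]_n) (g : vert a -> vec3).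
Implicit Types (b : forall i, 'I_(a i)).

Lemma spec_lt (i : 'I_5) : ((a i).-1 < a i)%N.
Proof. by rewrite ltn_predL. Qed.

Definition spec (i : 'I_5) : 'I_(a i) := Ordinal (spec_lt i).
Definition svert (i : 'I_5) : vert a := pent_vertex spec i.

Definition pent g b (k : nat) : vec3 := g (pent_vertex b (inord k)).

(* g is a Gale dual of lam: the relations of lam are the functionals on g. *)
Definition gale lam g : Prop :=
  forall c, comb lam c = 0 <-> exists al, c =1 (fun v => dot3 al (g v)).

Definition normal g : Prop := forall i, (i < 3)%N -> g (svert (inord i)) = unit3 i.

Lemma pent_vertex_inj b : injective (pent_vertex b).
Proof. by move=> i j /(congr1 tag). Qed.

Definition trans3 b (i : nat) : {set vert a} :=
  [set pent_vertex b (inord i); pent_vertex b (inord ((i + 1) %% 5));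
       pent_vertex b (inord ((i + 2) %% 5))].

(** A class wholly inside the complement is none of [i], [i+1], [i+2] modulo 5; the two remaining
    classes are adjacent, so never at distance 2. *)
Lemma face_trans3 b i : (i < 5)%N -> isFace (~: trans3 b i).
Proof.
move=> lt_i; apply/forallP => j; apply/forallP => k; apply/implyP => adj.
have sub (l : 'I_5) : cls a l \subset ~: trans3 b i ->
    (val l \notin [:: i; (i + 1) %% 5; (i + 2) %% 5])%N.
  move=> /subsetP/(_ (pent_vertex b l)); rewrite !inE eqxx => /(_ isT).
  apply: contra => il; rewrite !(inj_eq (@pent_vertex_inj b)) -orbA.
  by rewrite -!(inj_eq val_inj) /= !inordK ?ltn_mod.
apply/negP => /andP[/sub + /sub]; move: adj; rewrite /nonadj.
rewrite -!(inj_eq val_inj) /= !inordK ?ltn_mod // !inE.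
move: (nat_of_ord j) (ltn_ord j) (nat_of_ord k) (ltn_ord k) => {}j lt_j {}k lt_k.
by move: i lt_i {sub} j lt_j k lt_k => [|[|[|[|[|//]]]]] _ [|[|[|[|[|//]]]]] _ [|[|[|[|[|//]]]]].
Qed.

(** No two full classes are at distance 2, so the full classes lie among two consecutive ones, and
    each of the other three has a vertex outside [s]. *)
Lemma isFace_trans3 (s : {set vert a}) : isFace s ->
  exists b (i : nat), [/\ (i < 5)%N & s \subset ~: trans3 b i].
Proof.
move=> face; pose full (k : nat) := cls a (inord k) \subset s.
have adj j k : (j < 5)%N -> (k = (j + 2) %% 5)%N -> ~~ (full j && full k).
  move=> lt_j def_k; move/forallP/(_ (inord j))/forallP/(_ (inord k)): face.
  by rewrite /nonadj inordK // def_k eqxx.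
have [i lt_i [f0 f1 f2]] : exists2 i, (i < 5)%N &
    [/\ ~~ full i, ~~ full ((i + 1) %% 5)%N & ~~ full ((i + 2) %% 5)%N].
  have : [|| [&& ~~ full 0, ~~ full 1 & ~~ full 2], [&& ~~ full 1, ~~ full 2 & ~~ full 3],
             [&& ~~ full 2, ~~ full 3 & ~~ full 4], [&& ~~ full 3, ~~ full 4 & ~~ full 0]
           | [&& ~~ full 4, ~~ full 0 & ~~ full 1]]%N.
    move: (@adj 0 2 isT erefl)%N (@adj 1 3 isT erefl)%N (@adj 2 4 isT erefl)%N.
    move: (@adj 3 0 isT erefl)%N (@adj 4 1 isT erefl)%N.
    by case: (full 0)%N; case: (full 1)%N; case: (full 2)%N; case: (full 3)%N; case: (full 4)%N.
  by case/or4P=> [|||/orP[]] /and3P[];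
    [exists 0%N | exists 1%N | exists 2%N | exists 3%N | exists 4%N].
(* The default [spec j] is taken only in full classes, which are not among the three classes of the
   transversal. *)
pose b j := odflt (spec j) [pick k : 'I_(a j) | existT _ j k \notin s].
have bP k : ~~ full k -> pent_vertex b (inord k) \notin s.
  case/subsetPn=> [[j x]]; rewrite inE /= => /eqP def_j; subst j => xs.
  rewrite /pent_vertex /b; case: pickP => [y //|/(_ x)].
  by rewrite xs.
exists b, i; split=> //; apply/subsetP => v vs; rewrite !inE -orbA.
apply/negP => /or3P[]/eqP def_v; move: vs; rewrite def_v; apply/negP; exact: bP.
Qed.

(** A relation supported on a face is a functional vanishing on a transversal of three consecutive
    classes; independence there makes the functional zero. *)
Lemma nonsing_gale lam g : gale lam g -> (forall b, valid5 (pent g b)) -> nonsing lam.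
Proof.
move=> galeP valid; apply/forallP => s; apply/implyP => /isFace_trans3[b [i [lt_i sb]]].
apply/free_combP => c /galeP[al def_c] cs.
have z v : v \in trans3 b i -> dot3 al (g v) = false.
  move=> vb; rewrite -def_c; apply: contraTF vb => /cs/(subsetP sb).
  by rewrite inE.
have /allP/(_ i) := valid b; rewrite mem_iota => /(_ lt_i)/indep3_eq0 al0 v.
by rewrite def_c (al0 al) //; apply: z; rewrite !inE eqxx ?orbT.
Qed.

(** A functional killing a transversal gives a relation supported on a face, hence the zero
    relation. The standard basis at the first three special vertices then shows that the functional
    is zero. *)
Lemma gale_valid lam g : normal g -> gale lam g -> nonsing lam ->
  forall b, valid5 (pent g b).
Proof.
move=> norm galeP /forallP ns b; apply/allP => i; rewrite mem_iota => /= lt_i.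
have /implyP/(_ (face_trans3 b lt_i))/free_combP fr := ns (~: trans3 b i).
apply: indep3P => al h0 h1 h2.
have := fr (fun v => dot3 al (g v)) _ _.
rewrite galeP => /(_ (ex_intro _ al (fun=> erefl))) al0.
have {}al0 v : dot3 al (g v) = false.
  apply: al0 => w; rewrite !inE; apply: contraL => /orP[/orP[]|]/eqP->.
  - by rewrite [dot3 _ _]h0.
  - by rewrite [dot3 _ _]h1.
  - by rewrite [dot3 _ _]h2.
move: (al0 (svert (inord 0))) (al0 (svert (inord 1))) (al0 (svert (inord 2))).
by rewrite !norm //; case: (al) => [[[] []] []].
Qed.

Lemma card_vert : #|{: vert a}| = (\sum_(i < 5) a i)%N.
Proof.
rewrite /vert card_tagged sumnE big_map big_enum.
by apply: eq_bigr => i _; rewrite card_ord.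
Qed.

(** A face with exactly [n] vertices, so a non-singular map sends it to a basis. *)
Definition base_face : {set vert a} := ~: trans3 spec 0.

Lemma base_faceE v : (v \notin base_face) =
  [|| v == svert (inord 0), v == svert (inord 1) | v == svert (inord 2)].
Proof. by rewrite !inE negbK -orbA !modn_small. Qed.

Lemma svert_eq (i j : nat) : (i < 5)%N -> (j < 5)%N ->
  (svert (inord i) == svert (inord j)) = (i == j).
Proof.
move=> lt_i lt_j; rewrite (inj_eq (@pent_vertex_inj spec)).
by rewrite -(inj_eq val_inj) /= !inordK.
Qed.

Lemma card_base_face : #|base_face| = n.
Proof.
rewrite cardsCs setCK card_vert; congr (_ - _)%N.
rewrite /trans3 !modn_small // !add0n -setUA cardsU1 cards2.
by rewrite !inE !svert_eq.
Qed.

Lemma nonsing_base_free lam : nonsing lam ->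
  free [seq lam v | v <- enum base_face].
Proof. by move=> /forallP/(_ base_face)/implyP; apply; exact: face_trans3. Qed.

Lemma nonsing_base_span lam : nonsing lam ->
  <<[seq lam v | v <- enum base_face]>>%VS = fullv.
Proof.
move/nonsing_base_free => fr; apply/eqP; rewrite eqEdim subvf /=.
move: fr; rewrite /free => /eqP ->.
by rewrite size_map -cardE card_base_face dimvf /dim /= mul1n.
Qed.

Lemma nonsing_span lam : nonsing lam -> <<[seq lam v | v <- enum [set: vert a]]>>%VS = fullv.
Proof.
move/nonsing_base_span => sp; apply/eqP; rewrite eqEsubv subvf -sp /=.
apply: sub_span => w /mapP[v _ ->]; apply: map_f.
by rewrite mem_enum inE.
Qed.

(** A basis change preserves relations; conversely, equal relations yield a basis change because a
    non-singular map spans. *)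
Lemma dj_relP lam mu : nonsing lam ->
  reflect (forall c, comb lam c = 0 <-> comb mu c = 0) (dj lam mu).
Proof.
move=> ns; apply: (iffP existsP) => [[g /andP[ug /forallP def]]|rels].
  by apply: (change_basis_rel ug) => v; apply/eqP.
have [g ug def] := rel_change_basis (nonsing_span ns) rels.
by exists g; rewrite ug; apply/forallP => v; apply/eqP.
Qed.

(* The special vertices outside the base face are expressed in the basis given by
   lam on that face; the coefficients are the coordinates of g. *)
Lemma gale_exists lam : nonsing lam -> exists g, normal g /\ gale lam g.
Proof.
move=> ns; have rel i : exists c, comb lam c = 0 /\
    forall v, v \notin base_face -> c v = (v == svert i).
  have := memvf (comb lam (pred1 (svert i))).
  rewrite -(nonsing_base_span ns) => /mem_span_comb[c rel_c eqc].
  by exists c.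
have [c0 [rel0 eq0]] := rel (inord 0); have [c1 [rel1 eq1]] := rel (inord 1).
have [c2 [rel2 eq2]] := rel (inord 2).
pose g v : vec3 := (c0 v, c1 v, c2 v).
have norm : normal g.
  move=> i lt_i; have nF : svert (inord i) \notin base_face.
    by rewrite base_faceE !svert_eq ?(ltn_trans lt_i) //; case: i lt_i => [|[|[]]].
  rewrite /g eq0 // eq1 // eq2 // !svert_eq ?(ltn_trans lt_i) //.
have comb_dot al : comb lam (fun v => dot3 al (g v)) = 0.
  rewrite /dot3 /g /= !comb_addb.
  by rewrite !comb_andb rel0 rel1 rel2 !scaler0 !addr0.
exists g; split=> // c; split=> [rel_c|[al /eq_comb->]]; last exact: comb_dot.
(* The functional agreeing with [c] at the three special vertices off [base_face]; the difference is
   a relation supported on that face, so it vanishes. *)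
pose al : vec3 := (c (svert (inord 0)), c (svert (inord 1)), c (svert (inord 2))).
have rel_sum : comb lam (fun v => c v (+) dot3 al (g v)) = 0.
  by rewrite comb_addb rel_c comb_dot addr0.
have /free_combP/(_ _ rel_sum) eq_c := nonsing_base_free ns.
exists al => v.
suff /eq_c/(_ v) : forall w, c w (+) dot3 al (g w) -> w \in base_face.
  by case: (c v); case: dot3.
move=> w; apply: contraLR; rewrite base_faceE => /or3P[]/eqP->; rewrite norm // /dot3 /al /=;
  by move: (c _) (c _) (c _) => [] [] [].
Qed.

End Gale.

(** * Normal forms of Gale duals as twists of a base pentagon *)

Section Twisted.
Variables (a : 'I_5 -> nat) (apos : forall i, (0 < a i)%N).
Notation svert := (svert apos).
Notation spec := (spec apos).
Implicit Types (g : vert a -> vec3) (D : {set vert a}) (b : forall i, 'I_(a i)).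

Definition twisted (t : nat) D (v : vert a) : vec3 :=
  twist t (fun=> v \in D) (tag v).

Definition free_verts (s : bool) (t : nat) : {set vert a} :=
  [set v | (v != svert (tag v)) && (val (tag v) \in side s t)].

Lemma eq_valid5 h h' : (forall i, (i < 5)%N -> h i = h' i) -> valid5 h = valid5 h'.
Proof.
move=> eq_h; apply: eq_in_all => i; rewrite mem_iota => /= lt_i.
by rewrite !eq_h // ltn_mod.
Qed.

Lemma pent_dfwith g b v k : (k < 5)%N ->
  pent g (dfwith b (tagged v)) k = upd (pent g b) (tag v) (g v) k.
Proof.
move=> lt_k; rewrite /pent /upd /pent_vertex.
case: eqVneq => [->|neq].
  by rewrite inord_val dfwith_in; case: (v).
by rewrite dfwith_out //; apply: contraNneq neq => ->; rewrite inordK.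
Qed.

Lemma twisted_structure g : normal apos g -> (forall b, valid5 (pent g b)) ->
  exists (t : 'I_5) s D, D \subset free_verts s t /\ g =1 twisted t D.
Proof.
move=> norm valid.
have norm_pent i : (i < 3)%N -> pent g spec i = unit3 i by exact: norm.
have [t lt_t [base3 base4]] :
    exists2 t, (t < 5)%N & pent g spec 3 = base t 3 /\ pent g spec 4 = base t 4.
  apply: valid5_type; rewrite (eq_valid5 (h' := pent g spec)) //.
  by case=> [|[|[|[|[|//]]]]] _ //=; rewrite norm_pent.
have baseE i : (i < 5)%N -> pent g spec i = base t i.
  by case: i => [|[|[|[|[|//]]]]] _ //=; rewrite norm_pent.
pose D := [set v | g v != base t (tag v)].
have DP v : v \in D -> g v = add3 (base t (tag v)) (dev t (tag v)) /\
    val (tag v) \in side true t ++ side false t.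
  rewrite inE => /eqP neq.
  (* The pentagon through [v] whose other vertices are special. *)
  have := valid (dfwith spec (tagged v)).
  rewrite (eq_valid5 (h' := upd (base t) (tag v) (g v))); last first.
    by move=> i lt_i; rewrite pent_dfwith // /upd baseE.
  by case/(valid5_upd lt_t (ltn_ord _)) => [/neq|].
have gE : g =1 twisted t D.
  move=> v; rewrite /twisted /twist; case: ifP => [/DP[]//|].
  by rewrite inE => /negbFE/eqP.
have Dspec v : v \in D -> v != svert (tag v).
  rewrite inE; apply: contraNneq => {1}->.
  by rewrite -baseE // /pent inord_val.
exists (Ordinal lt_t); case: (boolP (D \subset free_verts true t)) => [subT|].
  by exists true, D.
(* A deviating [v] outside [side true t] lies on the other side; a deviating [w] on [side true t]
   would share a pentagon with it. *)
case/subsetPn=> v vD; rewrite inE Dspec //= => vT; exists false, D; split=> //.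
apply/subsetP => w wD; rewrite inE Dspec //=.
have [_] := DP w wD; rewrite mem_cat => /orP[wT|//].
have [_] := DP v vD; rewrite mem_cat (negPf vT) /= => vF.
case/negP: (valid5_sides lt_t wT vF).
pose b := dfwith (dfwith spec (tagged v)) (tagged w).
rewrite (eq_valid5 (h' := pent g b)) //.
have neq_wv : val (tag w) != val (tag v) by apply: contraNneq vT => <-.
move=> i lt_i; apply/esym; rewrite pent_dfwith // /upd pent_dfwith // /upd.
rewrite /twist; case: (eqVneq i (tag w)) => [->|_] /=; first by case: (DP w wD).
case: (eqVneq i (tag v)) => [->|_]; first by case: (DP v vD).
exact: baseE.
Qed.

Lemma twisted_valid s t D b : (t < 5)%N -> D \subset free_verts s t ->
  valid5 (pent (twisted t D) b).
Proof.
move=> lt_t /subsetP Ds.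
rewrite (eq_valid5 (h' := twist t
  (fun k => (k < 5)%N && (pent_vertex b (inord k) \in D)))); last first.
  by move=> i lt_i; rewrite /pent /twisted /twist /= inordK // lt_i.
apply: (valid5_twist (s := s)) => // i /andP[lt_i /Ds].
by rewrite inE /= inordK // => /andP[].
Qed.

Lemma twisted_svert s t D i : D \subset free_verts s t ->
  twisted t D (svert i) = base t i.
Proof.
move=> /subsetP Ds; rewrite /twisted /twist; case: ifP => // /Ds.
by rewrite inE eqxx.
Qed.

Lemma twisted_normal s t D : D \subset free_verts s t -> normal apos (twisted t D).
Proof.
move=> Ds i lt_i; rewrite (twisted_svert _ Ds) inordK ?(ltn_trans lt_i) //.
by case: i lt_i => [|[|[]]].
Qed.

Lemma base_inj t t' : (t < 5)%N -> (t' < 5)%N ->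
  base t 3 = base t' 3 -> base t 4 = base t' 4 -> t = t'.
Proof.
by case: t => [|[|[|[|[|//]]]]] _; case: t' => [|[|[|[|[|//]]]]] _.
Qed.

Lemma add3_dev s t i : (t < 5)%N -> i \in side s t -> add3 (base t i) (dev t i) != base t i.
Proof.
move=> lt_t it.
have : all (fun s => all (fun t => all (fun i => add3 (base t i) (dev t i) != base t i)
  (side s t)) (iota 0 5)) [:: true; false] by vm_compute.
by move=> /allP/(_ s)/(_ _)/allP/(_ t)/(_ _)/allP/(_ i it); apply; rewrite ?mem_iota //; case: s it.
Qed.

(** [t] is read off at the special vertices, which never deviate; [D] is recovered because every
    admissible deviation is nonzero. *)
Lemma twisted_inj s s' t t' D D' : (t < 5)%N -> (t' < 5)%N ->
  D \subset free_verts s t -> D' \subset free_verts s' t' ->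
  twisted t D =1 twisted t' D' -> t = t' /\ D = D'.
Proof.
move=> lt_t lt_t' Ds Ds' eqD.
have eqb i : (i < 5)%N -> base t i = base t' i.
  move=> lt_i; move: (eqD (svert (inord i))).
  by rewrite (twisted_svert _ Ds) (twisted_svert _ Ds') inordK.
have eq_t : t = t' by apply: base_inj => //; apply: eqb.
split=> //; subst t'; apply/setP => v; move: (eqD v); rewrite /twisted /twist.
case: (boolP (v \in D)) => vD; case: (boolP (v \in D')) => // vD'.
  move/subsetP/(_ v vD): Ds; rewrite inE => /andP[_ /(add3_dev lt_t) neq eq].
  by rewrite eq eqxx in neq.
move/subsetP/(_ v vD'): Ds'; rewrite inE => /andP[_ /(add3_dev lt_t) neq eq].
by rewrite -eq eqxx in neq.
Qed.

End Twisted.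

Lemma addb_eqF (x y : bool) : x (+) y = false -> x = y.
Proof. by case: x; case: y. Qed.

(** * Relations of Lambda *)

Section LamRelations.
Variables (a : 'I_5 -> nat) (apos : forall i, (0 < a i)%N).
Notation n := (\sum_(i < 5) a i - 3)%N.
Notation svert := (svert apos).

Definition Abit (A : Achoice) (e j : nat) : bool :=
  if e == 0%N then
    nth false [:: true; false; true; true; if A is A3 then false else true] j
  else nth false [:: false; true; true; false; true] j.

Lemma AentryE A e j : Aentry A e j = (Abit A e j)%:R.
Proof. by rewrite /Aentry /Abit; case: (e == 0%N). Qed.

(** The equation of row [e < 2] of [Lam]: only special columns meet it, and class [k] plays role
    [k - r] modulo 5. *)
Definition top_row (r : nat) A (C : nat -> bool) (e : nat) : bool :=
  foldr (fun k => addb (Abit A e ((k + 5 - r) %% 5) && C k)) false (iota 0 5).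

(** The non-special vertices whose row has a 1 in the special column of the class of role 4, where
    [n1] and [n4] enter. *)
Definition lam_twist (r : 'I_5) (n1 n4 : nat -> 'F_2) : {set vert a} :=
  [set v | (v != svert (tag v)) &&
    ((tag v == rcls r 0) && (n1 (tagged v) != 0)
     || (tag v == rcls r 3) && (n4 (tagged v) != 0))].

Definition lam_type (r : nat) (A : Achoice) : nat :=
  ((r + if A is A3 then 2 else 1) %% 5)%N.

Lemma off_lt (i j : 'I_5) : (i < j)%N -> (off a i + (a i).-1 <= off a j)%N.
Proof.
move=> lt_ij; rewrite /off [X in (_ <= X)%N](bigD1 i) //= addnC leq_add2l.
rewrite big_mkcond [X in (_ <= X)%N]big_mkcond; apply: leq_sum => k _.
case: ifP => // lt_ki; rewrite (ltn_trans lt_ki lt_ij) /=.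
by rewrite -(inj_eq val_inj) neq_ltn lt_ki.
Qed.

Lemma off_bound (i : 'I_5) : (2 + (off a i + (a i).-1) <= n)%N.
Proof.
(* Positivity of the five [a j] makes their predecessors sum to [N - 5], so that [N - 3] is two
   more. *)
have -> : n = (2 + \sum_(j < 5) (a j).-1)%N.
  have -> : (\sum_(j < 5) a j = \sum_(j < 5) (a j).-1 + 5)%N.
    transitivity (\sum_(j < 5) ((a j).-1 + 1))%N.
      by apply: eq_bigr => j _; rewrite addn1 prednK.
    by rewrite big_split sum1_card card_ord.
  by lia.
rewrite leq_add2l [X in (_ <= X)%N](bigD1 i) //= addnC leq_add2l /off.
rewrite big_mkcond [X in (_ <= X)%N]big_mkcond; apply: leq_sum => k _.
by case: ifP => // lt_ki; rewrite -(inj_eq val_inj) neq_ltn lt_ki.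
Qed.

Lemma off_eq (i j : 'I_5) k q : (k < (a i).-1)%N -> (q < (a j).-1)%N ->
  (2 + off a i + k == 2 + off a j + q)%N = (i == j) && (k == q).
Proof.
move=> lt_k lt_q; case: (eqVneq i j) => [->|] /=; first by rewrite eqn_add2l.
rewrite -(inj_eq val_inj) neq_ltn /= => /orP[] /off_lt; lia.
Qed.

Lemma vert_eq (v : vert a) (i : 'I_5) (x : 'I_(a i)) :
  (v == existT _ i x) = (tag v == i) && (val (tagged v) == val x).
Proof.
case: v => j y /=; case: (eqVneq j i) => [eq_ij|neq] /=; last first.
  by apply: contraNF neq => /eqP/(congr1 tag)/= ->.
by subst j; rewrite -tag_eqE /tag_eq eqxx tagged_asE.
Qed.

Lemma svert_tag (v : vert a) :
  (v == svert (tag v)) = ~~ (tagged v < (a (tag v)).-1)%N.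
Proof.
rewrite vert_eq eqxx /= -leqNgt eqn_leq.
by rewrite -ltnS prednK // ltn_ord.
Qed.

Section Coordinates.
Variables (m : nat) (r : 'I_5) (A : Achoice) (n1 n4 : nat -> 'F_2).
Notation lam := (@Lam a m r A n1 n4).

Lemma comb_coord (c : vert a -> bool) (p : 'I_m) :
  (comb lam c) 0 p = \sum_v (c v)%:R * lam v 0 p.
Proof. by rewrite /comb summxE; apply: eq_bigr => v _; rewrite mxE. Qed.

Lemma sum_unitv (i : 'I_5) (x : nat -> 'F_2) (p : 'I_m) :
  (\sum_(q < (a i).-1) x q *: unitv m (2 + off a i + q)) 0 p =
  \sum_(q < (a i).-1) x q * ((nat_of_ord p == (2 + off a i + q)%N)%:R).
Proof. by rewrite summxE; apply: eq_bigr => q _; rewrite !mxE. Qed.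

Lemma sum_unitv_low (i : 'I_5) (x : nat -> 'F_2) (p : 'I_m) :
  (p < 2)%N -> (\sum_(q < (a i).-1) x q *: unitv m (2 + off a i + q)) 0 p = 0.
Proof.
move=> lt_p; rewrite sum_unitv big1 // => q _.
have /negPf-> : nat_of_ord p != (2 + off a i + q)%N by lia.
exact: mulr0.
Qed.

Lemma sum_unitv_high (i j : 'I_5) (x : nat -> 'F_2) k (p : 'I_m) :
  nat_of_ord p = (2 + off a i + k)%N -> (k < (a i).-1)%N ->
  (\sum_(q < (a j).-1) x q *: unitv m (2 + off a j + q)) 0 p = (i == j)%:R * x k.
Proof.
move=> def_p lt_k; rewrite sum_unitv.
case: (eqVneq i j) => [eq_ij|neq]; last first.
  rewrite big1 ?mul0r // => q _; rewrite def_p off_eq // (negPf neq) /=.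
  exact: mulr0.
subst j; rewrite (bigD1 (Ordinal lt_k)) //= def_p eqxx mulr1 mul1r.
rewrite big1 ?addr0 // => q neq; rewrite off_eq // eqxx /=.
by rewrite eq_sym -[k]/(val (Ordinal lt_k)) (inj_eq val_inj) (negPf neq) mulr0.
Qed.

Lemma sum_unitv_none (j : 'I_5) (x : nat -> 'F_2) (p : 'I_m) :
  (forall i k, (k < (a i).-1)%N -> nat_of_ord p != (2 + off a i + k)%N) ->
  (\sum_(q < (a j).-1) x q *: unitv m (2 + off a j + q)) 0 p = 0.
Proof.
move=> none; rewrite sum_unitv big1 // => q _.
by rewrite (negPf (none _ _ _)) ?mulr0.
Qed.

Lemma sum_unitv1 (i : 'I_5) : \sum_(q < (a i).-1) unitv m (2 + off a i + q) =
  \sum_(q < (a i).-1) (fun=> 1 : 'F_2) (val q) *: unitv m (2 + off a i + q).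
Proof. by apply: eq_bigr => q _; rewrite scale1r. Qed.

Lemma role_eq4 (i : 'I_5) : (role r i == 4 :> nat) = (i == rcls r 4).
Proof.
rewrite /role /rcls -(inj_eq val_inj) /= !inordK ?ltn_mod //.
by move: (nat_of_ord i) (ltn_ord i) (nat_of_ord r) (ltn_ord r)
  => [|[|[|[|[|//]]]]] _ [|[|[|[|[|//]]]]] _.
Qed.

Lemma Lam_top (p : 'I_m) v : (p < 2)%N ->
  lam v 0 p = ((v == svert (tag v)) && Abit A p (role r (tag v)))%:R.
Proof.
move=> lt_p; rewrite svert_tag /Lam; case: ifP => lt_k /=.
  by rewrite mxE; have /negPf-> // : nat_of_ord p != (2 + off a (tag v) + tagged v)%N; lia.
rewrite sum_unitv1 !AentryE.
have z : (if role r (tag v) == 4 :> nat then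
       \sum_(q < (a (rcls r 0)).-1) n1 q *: unitv m (2 + off a (rcls r 0) + q)
     + \sum_(q < (a (rcls r 3)).-1) n4 q *: unitv m (2 + off a (rcls r 3) + q)
     else 0) 0 p = 0.
  case: ifP => _; last by rewrite mxE.
  by rewrite mxE !sum_unitv_low // addr0.
rewrite !mxE in z *; rewrite z (sum_unitv_low _ (fun=> 1)) // !addr0.
move: lt_p; case: (nat_of_ord p) => [|[|//]] _.
  by rewrite mulr1 mulr0 addr0.
by rewrite mulr1 mulr0 add0r.
Qed.

(** This is the row of the non-special vertex [w]: the first two terms come from its block [S], the
    third from the columns [n1] and [n4]. *)
Lemma Lam_high (p : 'I_m) (w : vert a) v :
  nat_of_ord p = (2 + off a (tag w) + tagged w)%N -> w != svert (tag w) ->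
  lam v 0 p = (v == w)%:R + (v == svert (tag w))%:R
    + (v == svert (rcls r 4))%:R * (w \in lam_twist r n1 n4)%:R.
Proof.
move=> def_p w_ns; have lt_w : (tagged w < (a (tag w)).-1)%N.
  by move: w_ns; rewrite svert_tag negbK.
have w_eq : (v == w) = (tag v == tag w) && (val (tagged v) == val (tagged w)).
  by case: w {def_p w_ns lt_w} => i x; exact: vert_eq.
have s_eq i : (v == svert i) = ~~ (tagged v < (a (tag v)).-1)%N && (tag v == i).
  rewrite -svert_tag; apply/eqP/andP => [->|[/eqP-> /eqP<-]//].
  by rewrite !eqxx.
rewrite /Lam; case: ifP => lt_k.
  rewrite mxE def_p eq_sym off_eq // w_eq.
  by rewrite !s_eq lt_k mul0r !addr0.
have -> : (v == w) = false by apply: contraNF w_ns => /eqP <-; rewrite svert_tag lt_k.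
rewrite !s_eq lt_k /= add0r sum_unitv1 role_eq4.
have tw : (w \in lam_twist r n1 n4)%:R =
    (tag w == rcls r 0)%:R * n1 (tagged w) + (tag w == rcls r 3)%:R * n4 (tagged w).
  rewrite inE w_ns /=.
  (* Roles 0 and 3 are distinct classes, so the disjunction in [lam_twist] becomes a sum in
     ['F_2]. *)
  have : ~~ ((tag w == rcls r 0) && (tag w == rcls r 3)).
    apply/negP => /andP[/eqP-> /eqP/(congr1 val)]; rewrite /= !inordK ?ltn_mod //.
    by move: (nat_of_ord r) (ltn_ord r) => [|[|[|[|[|//]]]]] _.
  case: (tag w == _) => /=; last by rewrite mul0r add0r; case: (tag w == _);
    rewrite ?mul1r ?mul0r //= natrF2_neq0.
  by move/negPf=> ->; rewrite orbF mul1r mul0r addr0 natrF2_neq0.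
have last_col : (if tag v == rcls r 4 then
       \sum_(q < (a (rcls r 0)).-1) n1 q *: unitv m (2 + off a (rcls r 0) + q)
     + \sum_(q < (a (rcls r 3)).-1) n4 q *: unitv m (2 + off a (rcls r 3) + q)
     else 0) 0 p = (tag v == rcls r 4)%:R * (w \in lam_twist r n1 n4)%:R.
  case: ifP => _; last by rewrite mxE mul0r.
  by rewrite mxE !(sum_unitv_high _ _ def_p lt_w) tw mul1r.
rewrite !mxE in last_col *; rewrite last_col (sum_unitv_high _ (fun=> 1) def_p lt_w) mulr1.
rewrite (eq_sym (tag w)).
have [-> ->] : (nat_of_ord p == 0)%N = false /\ (nat_of_ord p == 1)%N = false by lia.
by rewrite !mulr0 !add0r.
Qed.

(** Since [m] is a parameter, there may be coordinates beyond all blocks; they vanish. *)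
Lemma Lam_none (p : 'I_m) v : (1 < p)%N ->
  (forall i k, (k < (a i).-1)%N -> nat_of_ord p != (2 + off a i + k)%N) -> lam v 0 p = 0.
Proof.
move=> gt_p none; rewrite /Lam; case: ifP => lt_k.
  by rewrite mxE (negPf (none _ _ lt_k)).
rewrite sum_unitv1.
have z : (if role r (tag v) == 4 :> nat then
       \sum_(q < (a (rcls r 0)).-1) n1 q *: unitv m (2 + off a (rcls r 0) + q)
     + \sum_(q < (a (rcls r 3)).-1) n4 q *: unitv m (2 + off a (rcls r 3) + q)
     else 0) 0 p = 0.
  case: ifP => _; last by rewrite mxE.
  by rewrite mxE !sum_unitv_none // addr0.
rewrite !mxE in z *; rewrite z (sum_unitv_none _ (fun=> 1)) // !addr0.
have [-> ->] : (nat_of_ord p == 0)%N = false /\ (nat_of_ord p == 1)%N = false by lia.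
by rewrite !mulr0 addr0.
Qed.

(** Read row by row: the top two rows constrain the values at special vertices, and the row of a
    non-special [v] solves for [c v]. The bound ensures that these rows exist. *)
Lemma Lam_relP (c : vert a -> bool) :
  (forall i : 'I_5, (2 + (off a i + (a i).-1) <= m)%N) -> comb lam c = 0 <->
  (forall e, (e < 2)%N -> top_row r A (fun k => c (svert (inord k))) e = false) /\
  (forall v, c v = c (svert (tag v)) (+)
                   ((v \in lam_twist r n1 n4) && c (svert (rcls r 4)))).
Proof.
move=> bound.
have sum_delta w (y : 'F_2) : \sum_v (c v)%:R * ((v == w)%:R * y) = (c w)%:R * y.
  rewrite (bigD1 w) //= eqxx mul1r big1 ?addr0 // => v /negPf ->.
  by rewrite mul0r mulr0.
have top (p : 'I_m) : (p < 2)%N ->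
    (comb lam c) 0 p = (top_row r A (fun k => c (svert (inord k))) p)%:R.
  move=> lt_p; rewrite comb_coord.
  transitivity (\sum_(v : vert a) \sum_(i < 5)
        (c v)%:R * ((v == svert i)%:R * (Abit A p (role r i))%:R) : 'F_2).
    apply: eq_bigr => v _; rewrite Lam_top // (bigD1 (tag v)) //= big1 ?addr0.
      by congr (_ * _); case: eqP; rewrite ?mul1r ?mul0r.
    move=> i neq; case: (eqVneq v (svert i)) => [def_v|]; last by rewrite mul0r mulr0.
    by rewrite def_v eqxx in neq.
  rewrite exchange_big /=.
  pose H k : 'F_2 := (Abit A p ((k + 5 - r) %% 5) && c (svert (inord k)))%:R.
  transitivity (\sum_(i < 5) H i).
    apply: eq_bigr => i _; rewrite sum_delta /H inord_val /role inordK ?ltn_mod //.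
    by case: (c _); case: (Abit _ _ _); rewrite ?mulr0 ?mul0r ?mulr1.
  by rewrite !big_ord_recl big_ord0 /top_row /= !natrF2_addb.
have high (w : vert a) (p : 'I_m) : nat_of_ord p = (2 + off a (tag w) + tagged w)%N ->
    w != svert (tag w) -> (comb lam c) 0 p =
    (c w (+) (c (svert (tag w)) (+) ((w \in lam_twist r n1 n4) && c (svert (rcls r 4)))))%:R.
  move=> def_p w_ns; rewrite comb_coord.
  under eq_bigr => v _ do
    rewrite (Lam_high _ def_p w_ns) !mulrDr -[(v == w)%:R]mulr1
      -[(v == svert (tag w))%:R]mulr1.
  rewrite !big_split /= !sum_delta !mulr1 !natrF2_addb addrA.
  by congr (_ + _ + _); case: (c _); case: (_ \in _); rewrite ?mulr0 ?mul0r ?mulr1.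
split=> [rel_c|[tops eqs]].
  split=> [e lt_e|v].
    have lt_em : (e < m)%N by have := bound ord0; lia.
    by apply: natrF2_inj; rewrite -(top (Ordinal lt_em)) // rel_c mxE.
  case: (eqVneq v (svert (tag v))) => [def_v|v_ns].
    have -> : v \in lam_twist r n1 n4 = false by rewrite inE -def_v eqxx.
    by rewrite -def_v addbF.
  have lt_vm : (2 + off a (tag v) + tagged v < m)%N.
    have := bound (tag v); move: v_ns; rewrite svert_tag negbK; lia.
  have := high v (Ordinal lt_vm) erefl v_ns.
  by rewrite rel_c mxE => /esym/(@natrF2_inj _ false)/addb_eqF.
apply/rowP => p; rewrite [RHS]mxE.
case: (ltnP p 2) => [lt_p|ge_p]; first by rewrite top // tops.
case: (boolP [exists i : 'I_5, exists k : 'I_(a i),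
    (k < (a i).-1)%N && (nat_of_ord p == 2 + off a i + k)%N]).
  case/existsP=> i /existsP[k /andP[lt_k /eqP def_p]].
  pose w : vert a := existT _ i k.
  rewrite (high w) //; last by rewrite svert_tag negbK.
  by rewrite eqs addbb.
move=> none; rewrite comb_coord big1 // => v _; rewrite Lam_none ?mulr0 // => i k lt_k.
apply: contraNneq none => def_p; apply/existsP; exists i.
have lt_ka : (k < a i)%N by lia.
by apply/existsP; exists (Ordinal lt_ka); rewrite lt_k def_p /=.
Qed.

End Coordinates.

(** The solutions of the two rows of [A] are parametrised by their first three values, and
    evaluating them at the five classes gives the base pentagon. Checked over all rotations and bit
    patterns. *)
Lemma top_row_base (r : nat) A (C : nat -> bool) : (r < 5)%N ->
  (forall e, (e < 2)%N -> top_row r A C e = false) <->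
  (forall k, (k < 5)%N -> C k = dot3 (C 0%N, C 1%N, C 2%N) (base (lam_type r A) k)).
Proof.
move=> lt_r; have key : ~~ top_row r A C 0 && ~~ top_row r A C 1 =
    all (fun k => C k == dot3 (C 0, C 1, C 2) (base (lam_type r A) k))%N (iota 0 5).
  rewrite /top_row /dot3 /=.
  move: (C 0) (C 1) (C 2) (C 3) (C 4)%N => c0 c1 c2 c3 c4.
  by case: A; move: r lt_r => [|[|[|[|[|//]]]]] _;
    case: c0; case: c1; case: c2; case: c3; case: c4.
split=> [H k lt_k|H].
  move: key; rewrite !H // => /esym/allP/(_ k); rewrite mem_iota => /(_ lt_k).
  by move/eqP.
move: key; rewrite (introT allP) => [|k]; last first.
  by rewrite mem_iota => lt_k; rewrite -H.
by case/andP=> [/negPf H0 /negPf H1] [|[|//]] _.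
Qed.

Lemma rcls_val (r : 'I_5) j : rcls r j = ((r + j) %% 5)%N :> nat.
Proof. by rewrite /rcls inordK ?ltn_mod. Qed.

Definition is_A3 (A : Achoice) : bool := if A is A3 then true else false.

(** Explains the place of [n1] and [n4] in [Lam]: they sit in a column of class [r+4], whose vector
    is the admissible deviation of classes [r] and [r+3]. *)
Lemma dev_lam_type (r i : nat) A : (r < 5)%N ->
  (i == r) || (i == (r + 3) %% 5)%N ->
  (i \in side (is_A3 A) (lam_type r A)) /\
  dev (lam_type r A) i = base (lam_type r A) ((r + 4) %% 5)%N.
Proof.
by case: A; move: r => [|[|[|[|[|//]]]]] _ /orP[]/eqP->.
Qed.

Lemma lam_twist_sub r A n1 n4 :
  lam_twist r n1 n4 \subset free_verts apos (is_A3 A) (lam_type r A).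
Proof.
apply/subsetP => v; rewrite !inE => /andP[-> /=].
move=> rv; apply: (dev_lam_type A (ltn_ord r) _).1.
by case/orP: rv => /andP[/eqP/(congr1 val)/= -> _];
  rewrite rcls_val ?addn0 ?(modn_small (ltn_ord r)) eqxx ?orbT.
Qed.

Lemma lam_twist_dev r A n1 n4 v : v \in lam_twist r n1 n4 ->
  dev (lam_type r A) (tag v) = base (lam_type r A) (rcls r 4).
Proof.
rewrite inE => /andP[_ rv].
rewrite [in RHS]rcls_val; apply: (dev_lam_type A (ltn_ord r) _).2.
by case/orP: rv => /andP[/eqP/(congr1 val)/= -> _];
  rewrite rcls_val ?addn0 ?(modn_small (ltn_ord r)) eqxx ?orbT.
Qed.

Lemma dot3_add (al u v : vec3) : dot3 al (add3 u v) = dot3 al u (+) dot3 al v.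
Proof. by case: al u v => [[[] []] []] [[[] []] []] [[[] []] []]. Qed.

Lemma lam_type_lt r A : (lam_type r A < 5)%N.
Proof. exact: ltn_mod. Qed.

(** The row equations give [c v] as the value at the special vertex of its class plus, on [D], the
    value at class [r+4]; that is a functional evaluated on [base] plus [dev]. *)
Lemma Lam_gale r A n1 n4 :
  gale (@Lam a n r A n1 n4) (twisted (lam_type r A) (lam_twist r n1 n4)).
Proof.
move=> c; rewrite Lam_relP; last exact: off_bound.
rewrite top_row_base //; set t := lam_type r A; set D := lam_twist r n1 n4.
have dot_tw al v : dot3 al (twisted t D v) =
    dot3 al (base t (tag v)) (+) ((v \in D) && dot3 al (base t (rcls r 4))).
  rewrite /twisted /twist; case: ifP => vD; last by rewrite addbF.
  by rewrite dot3_add (lam_twist_dev _ vD).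
split=> [[C_base cE]|[al cE]].
  exists (c (svert (inord 0)), c (svert (inord 1)), c (svert (inord 2))) => v.
  by rewrite dot_tw -!C_base ?ltn_ord // !inord_val -cE.
have C_base i : c (svert i) = dot3 al (base t i).
  by rewrite cE (twisted_svert _ (lam_twist_sub r A n1 n4)).
split=> [k lt_k|v]; last by rewrite !C_base cE dot_tw.
by rewrite !C_base !inordK //; case: al {cE C_base dot_tw} => [[[] []] []].
Qed.

Lemma Lam_nonsing r A n1 n4 : nonsing (@Lam a n r A n1 n4).
Proof.
apply: (nonsing_gale apos (Lam_gale r A n1 n4)) => b.
exact: twisted_valid b (lam_type_lt r A) (lam_twist_sub r A n1 n4).
Qed.

End LamRelations.

(** * Counting Davis-Januszkiewicz classes *)

Definition dj_class (a : 'I_5 -> nat) (m : nat) (lam : vert a -> 'rV['F_2]_m) :=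
  [set mu : {ffun vert a -> 'rV['F_2]_m} | dj lam mu].

Lemma mem_dj_class a m (lam : vert a -> 'rV['F_2]_m) (mu : {ffun vert a -> 'rV['F_2]_m}) :
  (mu \in dj_class lam) = dj lam mu.
Proof. exact: in_set. Qed.

Lemma dj_class_eqP a m (lam mu : vert a -> 'rV['F_2]_m) :
  (forall nu : {ffun vert a -> 'rV['F_2]_m}, dj lam nu = dj mu nu) <->
  dj_class lam = dj_class mu.
Proof.
split=> [eq_dj | /setP eq_cls nu].
  by apply/setP => nu; exact: etrans (etrans (mem_dj_class lam nu) (eq_dj nu))
    (esym (mem_dj_class mu nu)).
exact: etrans (etrans (esym (mem_dj_class lam nu)) (eq_cls nu)) (mem_dj_class mu nu).
Qed.

Lemma comb_ffun (V : finType) m (lam : V -> 'rV['F_2]_m) c :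
  comb [ffun v => lam v] c = comb lam c.
Proof. by apply: eq_bigr => v _; rewrite ffunE. Qed.

Section Classes.
Variables (a : 'I_5 -> nat) (apos : forall i, (0 < a i)%N).
Notation n := (\sum_(i < 5) a i - 3)%N.
Notation svert := (svert apos).
Notation free_verts := (free_verts apos).
Implicit Types (lam mu : vert a -> 'rV['F_2]_n) (g : vert a -> vec3) (D : {set vert a}).

(** A coordinate of [g] is a relation of [lam], hence a functional on [g']; the three normalised
    vertices force it to be the same coordinate. *)
Lemma gale_uniq lam g g' : normal apos g -> normal apos g' ->
  gale lam g -> gale lam g' -> g =1 g'.
Proof.
move=> norm norm' galeP galeP' v.
have eq_dot j : (j < 3)%N -> dot3 (unit3 j) (g v) = dot3 (unit3 j) (g' v).
  move=> lt_j; have /galeP/galeP'[al eq_al] :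
      exists al, (fun w => dot3 (unit3 j) (g w)) =1 (fun w => dot3 al (g w)).
    by exists (unit3 j).
  rewrite eq_al; congr (dot3 _ _).
  move: (eq_al (svert (inord 0))) (eq_al (svert (inord 1))) (eq_al (svert (inord 2))).
  rewrite !norm // !norm' // => {eq_al}.
  by case: j lt_j => [|[|[|//]]] _; case: al => [[[] []] []].
move: (eq_dot 0 isT)%N (eq_dot 1 isT)%N (eq_dot 2 isT)%N.
by case: (g v) (g' v) => [[[] []] []] [[[] []] []].
Qed.

Lemma gale_eq lam g g' : g =1 g' -> gale lam g -> gale lam g'.
Proof.
move=> eq_g galeP c; rewrite galeP.
by split=> -[al eq_c]; exists al => v; rewrite eq_c eq_g.
Qed.

Lemma gale_rel lam mu g : gale lam g -> gale mu g ->
  forall c, comb lam c = 0 <-> comb mu c = 0.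
Proof. by move=> galeP galeP' c; rewrite galeP galeP'. Qed.

(** Inverts [lam_type]: subtracts 2 (for [A3]) or 1 (for [A2]) modulo 5. *)
Definition rot (s : bool) (t : nat) : 'I_5 :=
  inord ((t + if s then 3 else 4) %% 5).

Definition twist_bits D (i : 'I_5) (k : nat) : 'F_2 :=
  [exists x : 'I_(a i), (val x == k) && (existT _ i x \in D)]%:R.

Definition LamD (s : bool) (t : nat) D : vert a -> 'rV['F_2]_n :=
  @Lam a n (rot s t) (if s then A3 else A2) (twist_bits D (rcls (rot s t) 0))
     (twist_bits D (rcls (rot s t) 3)).

Lemma lam_type_rot s t : (t < 5)%N -> lam_type (rot s t) (if s then A3 else A2) = t.
Proof.
by rewrite /lam_type /rot inordK ?ltn_mod //; case: s; move: t => [|[|[|[|[|//]]]]].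
Qed.

Lemma twist_bitsE D (v : vert a) : (twist_bits D (tag v) (tagged v) != 0) = (v \in D).
Proof.
rewrite /twist_bits; have -> (e : bool) : ((e%:R : 'F_2) != 0) = e by case: e.
case: v => i x /=; apply/existsP/idP => [[y /andP[/eqP/val_inj->]]//|xD].
by exists x; rewrite eqxx.
Qed.

Lemma side_rot s t i : (t < 5)%N -> (i < 5)%N -> i \in side s t ->
  (i == (rot s t + 0) %% 5)%N || (i == (rot s t + 3) %% 5)%N.
Proof.
move=> lt_t lt_i; rewrite /rot inordK ?ltn_mod //.
case: s; move: t lt_t => [|[|[|[|[|//]]]]] _;
  by move: i lt_i => [|[|[|[|[|//]]]]] _.
Qed.

Lemma lam_twist_rot s t D : (t < 5)%N -> D \subset free_verts s t ->
  lam_twist apos (rot s t) (twist_bits D (rcls (rot s t) 0))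
     (twist_bits D (rcls (rot s t) 3)) = D.
Proof.
move=> lt_t /subsetP Ds; apply/setP => v; rewrite inE.
have bits (i : 'I_5) : (tag v == i) && (twist_bits D i (tagged v) != 0) =
    (tag v == i) && (v \in D).
  by case: eqP => // <-; rewrite twist_bitsE.
rewrite !bits -andb_orl andbA; apply/andP/idP => [[]//|vD]; split=> //.
have := Ds v vD; rewrite inE => /andP[-> /= /(side_rot lt_t (ltn_ord _))].
by rewrite -!rcls_val !(inj_eq val_inj).
Qed.

Lemma LamD_gale s t D : (t < 5)%N -> D \subset free_verts s t ->
  gale (LamD s t D) (twisted t D).
Proof.
move=> lt_t Ds; rewrite -{2}(lam_type_rot s lt_t) -{2}(lam_twist_rot lt_t Ds).
exact: Lam_gale.
Qed.

Lemma LamD_nonsing s t D : nonsing (LamD s t D).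
Proof. exact: Lam_nonsing. Qed.

Lemma nonsing_twisted lam : nonsing lam ->
  exists (t : 'I_5) s D, D \subset free_verts s t /\ gale lam (twisted t D).
Proof.
move=> ns; have [g [norm galeP]] := gale_exists apos ns.
have [t [s [D [Ds eq_g]]]] := twisted_structure norm (gale_valid norm galeP ns).
by exists t, s, D; split=> //; exact: gale_eq eq_g galeP.
Qed.

Lemma nonsing_dj_Lam lam : nonsing lam ->
  exists (r : 'I_5) (A : Achoice) (n1 n4 : nat -> 'F_2), dj (@Lam a n r A n1 n4) lam.
Proof.
move=> ns; have [t [s [D [Ds galeP]]]] := nonsing_twisted ns.
exists (rot s t), (if s then A3 else A2), (twist_bits D (rcls (rot s t) 0)),
  (twist_bits D (rcls (rot s t) 3)).
apply/(dj_relP apos _ (LamD_nonsing s t D)).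
exact: gale_rel (LamD_gale (ltn_ord t) Ds) galeP.
Qed.

Lemma nonsing_ffun lam : nonsing [ffun v => lam v] = nonsing lam.
Proof.
by apply: eq_forallb => S; congr (_ ==> free _); apply: eq_map => v; rewrite ffunE.
Qed.

(** A union over the two sides, since the empty set of deviations lies on both and must count
    once. *)
Definition twists : {set 'I_5 * {set vert a}} :=
  [set p : 'I_5 * {set vert a} | (p.2 \subset free_verts true p.1)
                                 || (p.2 \subset free_verts false p.1)].

Definition twist_lam (p : 'I_5 * {set vert a}) : vert a -> 'rV['F_2]_n :=
  LamD (p.2 \subset free_verts true p.1) p.1 p.2.

Lemma twistsP p : p \in twists ->
  p.2 \subset free_verts (p.2 \subset free_verts true p.1) p.1.
Proof. by rewrite inE; case: (boolP (_ \subset free_verts true _)). Qed.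

(** The class of [mu] contains [mu] in its finite-function form, so equal classes force equal
    relations. *)
Lemma eq_dj_classP lam mu : nonsing lam -> nonsing mu ->
  (forall c, comb lam c = 0 <-> comb mu c = 0) <-> dj_class lam = dj_class mu.
Proof.
move=> nl nm; split=> [rels|/dj_class_eqP eq_dj].
  apply/dj_class_eqP => nu.
  by apply/(dj_relP apos _ nl)/(dj_relP apos _ nm) => H c; rewrite -H rels.
have /(dj_relP apos _ nl) rels : dj lam [ffun v => mu v].
  by rewrite eq_dj; apply/(dj_relP apos _ nm) => c; rewrite comb_ffun.
by move=> c; rewrite rels comb_ffun.
Qed.

Lemma dj_class_ffun lam : nonsing lam -> dj_class [ffun v => lam v] = dj_class lam.
Proof.
move=> nl; apply/eq_dj_classP => // [|c]; first by rewrite nonsing_ffun.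
by rewrite comb_ffun.
Qed.

Lemma dj_classesE :
  [set dj_class lam | lam : {ffun vert a -> 'rV['F_2]_n} in
    [set lam : {ffun vert a -> 'rV['F_2]_n} | nonsing lam]]
  = [set dj_class (twist_lam p) | p in twists].
Proof.
apply/setP => C; apply/imsetP/imsetP => [[lam]|[p pP ->]].
  rewrite in_set => ns ->; have [t [s [D [Ds galeP]]]] := nonsing_twisted ns.
  have pP : (t, D) \in twists by rewrite in_set /=; case: s Ds => ->; rewrite ?orbT.
  exists (t, D); first exact: pP.
  apply/(eq_dj_classP ns (LamD_nonsing _ _ _)).
  exact: gale_rel galeP (LamD_gale (ltn_ord t) (twistsP pP)).
exists [ffun v => twist_lam p v]; first by rewrite in_set nonsing_ffun LamD_nonsing.
by rewrite dj_class_ffun // LamD_nonsing.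
Qed.

(** A common class means a common Gale dual, and uniqueness of the normalised dual recovers the
    pair. *)
Lemma dj_class_inj : {in twists &, injective (fun p => dj_class (twist_lam p))}.
Proof.
move=> p p' pP pP' /(eq_dj_classP (LamD_nonsing _ _ _) (LamD_nonsing _ _ _)) rels.
have galeP := LamD_gale (ltn_ord p.1) (twistsP pP).
have galeP' := LamD_gale (ltn_ord p'.1) (twistsP pP').
have galeP2 : gale (twist_lam p') (twisted p.1 p.2) by move=> c; rewrite -rels galeP.
have eq_tw := gale_uniq (twisted_normal (twistsP pP)) (twisted_normal (twistsP pP'))
   galeP2 galeP'.
have [/val_inj eq1 eq2] :=
  twisted_inj (ltn_ord p.1) (ltn_ord p'.1) (twistsP pP) (twistsP pP') eq_tw.
by rewrite [p]surjective_pairing eq1 eq2 -surjective_pairing.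
Qed.

Lemma num_dj_twists : num_dj_classes a n = #|twists|.
Proof.
exact: etrans (congr1 (fun C : {set {set {ffun vert a -> 'rV['F_2]_n}}} => #|C|) dj_classesE)
  (card_in_imset dj_class_inj).
Qed.

(** * Counting the pairs of a type and a set of deviating vertices *)

Lemma card_free_verts s t : #|free_verts s t| =
  (\sum_(i < 5 | val i \in side s t) (a i).-1)%N.
Proof.
rewrite -sum1_card.
transitivity (\sum_(i < 5 | val i \in side s t) \sum_(x < a i | (x < (a i).-1)%N) 1)%N.
  rewrite sig_big_dep /=; apply: eq_bigl => v; rewrite inE svert_tag negbK andbC.
  by [].
apply: eq_bigr => i _; rewrite -(big_ord_widen _ (fun=> 1%N)) ?leq_pred //.
by rewrite sum1_card card_ord.
Qed.

Lemma card_twists : #|twists| =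
  (\sum_(t < 5) (2 ^ #|free_verts true t| + 2 ^ #|free_verts false t| - 1))%N.
Proof.
rewrite -sum1_card.
transitivity (\sum_(t < 5) \sum_(D : {set vert a} | (D \subset free_verts true t)
    || (D \subset free_verts false t)) 1)%N.
  by rewrite pair_big_dep /=; apply: eq_bigl => p; rewrite inE.
apply: eq_bigr => t _; rewrite sum1_card.
have -> : #|[pred D : {set vert a} | (D \subset free_verts true t)
                                   || (D \subset free_verts false t)]|
   = #|powerset (free_verts true t) :|: powerset (free_verts false t)|.
  by apply: eq_card => D; rewrite !inE.
(* Inclusion-exclusion: the two sides are disjoint, so the powersets share only the empty set. *)
rewrite cardsU !card_powerset -powersetI card_powerset.
suff -> : free_verts true t :&: free_verts false t = set0 by rewrite cards0.
apply/setP => v; rewrite !inE; apply/negP => /andP[/andP[_ vT] /andP[_ vF]].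
move: (nat_of_ord t) (ltn_ord t) (nat_of_ord (tag v)) vT vF => {}t lt_t i.
by move: t lt_t => [|[|[|[|[|//]]]]] _ /orP[]/eqP->.
Qed.

Lemma card_free_vertsE s (t : 'I_5) : #|free_verts s t| =
  ((a (inord (nth 0 (side s t) 0))).-1 + (a (inord (nth 0 (side s t) 1))).-1)%N.
Proof.
rewrite card_free_verts big_mkcond !big_ord_recl big_ord0 /=.
pose x k := (a (inord k)).-1.
have xE (i : 'I_5) k : i = k :> nat -> (a i).-1 = x k.
  by rewrite /x => <-; rewrite inord_val.
rewrite (xE _ 0%N) // (xE _ 1%N) // (xE _ 2%N) // (xE _ 3%N) // (xE _ 4%N) //.
rewrite -!/(x _) /bump /=.
case: t => t lt_t /=; case: s; move: t lt_t => [|[|[|[|[|//]]]]] _;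
  by rewrite /= ?addn0 ?add0n // addnC.
Qed.

(** Each pair of classes at distance 2 occurs for two types, once on each side, and the doubling
    raises the exponent [(a i).-1 + (a j).-1] by one. *)
Lemma twists_formula : #|twists| =
  (2 ^ (a ord0 + a (inord 3)).-1 + 2 ^ (a (inord 1) + a (inord 4)).-1
   + 2 ^ (a (inord 2) + a ord0).-1 + 2 ^ (a (inord 3) + a (inord 1)).-1
   + 2 ^ (a (inord 4) + a (inord 2)).-1 - 5)%N.
Proof.
have dbl (i j : 'I_5) : (2 ^ (a i + a j).-1 = 2 ^ ((a i).-1 + (a j).-1) * 2)%N.
  by rewrite -expnSr; congr (_ ^ _)%N; move: (apos i) (apos j); lia.
have -> : (ord0 : 'I_5) = inord 0 by apply/val_inj; rewrite /= inordK.
rewrite card_twists !dbl !big_ord_recl big_ord0 !card_free_vertsE /=.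
pose E i j := (2 ^ ((a (inord i)).-1 + (a (inord j)).-1))%N.
have E_sym i j : E i j = E j i by rewrite /E addnC.
have E_gt0 i j : (0 < E i j)%N by rewrite expn_gt0.
rewrite -!/(E _ _).
transitivity ((E 1 3 + E 4 2 - 1) + ((E 2 4 + E 0 3 - 1) + ((E 3 0 + E 1 4 - 1)
  + ((E 4 1 + E 2 0 - 1) + ((E 0 2 + E 3 1 - 1) + 0)))))%N; first by [].
rewrite (E_sym 1 3) (E_sym 2 4) (E_sym 3 0) (E_sym 4 1) (E_sym 0 2)%N.
(* Positivity makes the five truncated subtractions of 1 exact, so that they add up to 5. *)
move: (E_gt0 3 1) (E_gt0 4 2) (E_gt0 0 3) (E_gt0 1 4) (E_gt0 2 0)%N.
by move: (E 3 1) (E 4 2) (E 0 3) (E 1 4) (E 2 0)%N; lia.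
Qed.

Lemma num_dj_classesE : num_dj_classes a n =
  (2 ^ (a ord0 + a (inord 3)).-1 + 2 ^ (a (inord 1) + a (inord 4)).-1
   + 2 ^ (a (inord 2) + a ord0).-1 + 2 ^ (a (inord 3) + a (inord 1)).-1
   + 2 ^ (a (inord 4) + a (inord 2)).-1 - 5)%N.
Proof. exact: etrans num_dj_twists twists_formula. Qed.

End Classes.

(** * Projections over pentagons *)

(** With [h] a Gale dual restricted to a pentagon, this says that [e] is a relation among the
    projected vectors. *)
Definition pent_rel (h : nat -> vec3) (e : nat -> bool) : bool :=
  has (fun al => all (fun k => dot3 al (h k) == e k) (iota 0 5)) all3.

Section Projections.
Variables (a : 'I_5 -> nat) (apos : forall i, (0 < a i)%N).
Notation n := (\sum_(i < 5) a i - 3)%N.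
Variables (lam : vert a -> 'rV['F_2]_n) (g : vert a -> vec3).
Hypothesis galeP : gale lam g.
Variable b : forall i, 'I_(a i).

(** Modulo the link span, coefficients off the pentagon may be changed freely, so the relations of
    the projection are the restrictions to the pentagon of the relations of [lam]. *)
Lemma link_span_rel (c : vert a -> bool) :
  (comb lam c \in link_span lam b) =
  pent_rel (pent g b) (fun k => c (pent_vertex b (inord k))).
Proof.
have pentE v : (v \notin [set w : vert a | tagged w != b (tag w)]) =
    (v == pent_vertex b (tag v)).
  rewrite inE negbK; case: v => i x.
  by rewrite vert_eq /= eqxx.
apply/mem_span_comb/hasP => [[c' /galeP[al def_c'] eq_c]|[al _ /allP eq_c]].
  exists al; first exact: mem_all3.
  by apply/allP => k _; rewrite -def_c' eq_c ?pentE.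
exists (fun v => dot3 al (g v)); first by apply/galeP; exists al.
move=> v; rewrite pentE => /eqP def_v.
have := eq_c (tag v); rewrite mem_iota ltn_ord => /(_ isT)/eqP.
by rewrite /pent inord_val -def_v.
Qed.

Lemma proj_eq_rel i j : (i < 5)%N -> (j < 5)%N ->
  proj_eq lam b (inord i) (inord j) =
  pent_rel (pent g b) (fun k => (k == i) (+) (k == j)).
Proof.
move=> lt_i lt_j; rewrite /proj_eq F2_oppv -(comb_pred1 lam (pent_vertex b (inord i))).
rewrite -(comb_pred1 lam (pent_vertex b (inord j))) -comb_addb.
rewrite link_span_rel; apply: eq_has => al; apply: eq_in_all => k.
rewrite mem_iota => lt_k /=; rewrite !(inj_eq (@pent_vertex_inj _ b)).
by rewrite -!(inj_eq val_inj) /= !inordK.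
Qed.

Lemma proj_nz_rel i : (i < 5)%N ->
  proj_nz lam b (inord i) = ~~ pent_rel (pent g b) (fun k => k == i).
Proof.
move=> lt_i; rewrite /proj_nz -(comb_pred1 lam (pent_vertex b (inord i))) link_span_rel.
congr (~~ _).
apply: eq_has => al; apply: eq_in_all => k.
rewrite mem_iota => lt_k /=; rewrite (inj_eq (@pent_vertex_inj _ b)).
by rewrite -(inj_eq val_inj) /= !inordK.
Qed.

Definition pent_type (h : nat -> vec3) (t : nat) : bool :=
  let s k := ((t + k) %% 5)%N in
  let eq i j := pent_rel h (fun k => (k == i) (+) (k == j)) in
  let nz i := ~~ pent_rel h (fun k => k == i) in
  [&& eq (s 1) (s 3), eq (s 2) (s 4), ~~ eq (s 1) (s 2), ~~ eq t (s 1),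
      ~~ eq t (s 2), nz t, nz (s 1) & nz (s 2)]%N.

Lemma proj_type_pent t : (t < 5)%N ->
  pent_type (pent g b) t -> proj_type lam b (inord t).
Proof.
move=> lt_t; rewrite /pent_type => /and5P[h1 h2 h3 h4 /and4P[h5 h6 h7 h8]].
by rewrite /proj_type !inordK // !proj_eq_rel ?proj_nz_rel ?ltn_mod.
Qed.

End Projections.

(** Classes 0 and 3 may each be shifted by the vector of class 4: one shift exchanges the two types,
    and a second one restores the type. *)
Lemma pent_type_twist (d : nat -> bool) A : ~~ d 1%N -> ~~ d 2%N -> ~~ d 4%N ->
  pent_type (twist (lam_type 0 A) d)
    (if d 0%N (+) d 3%N (+) is_A3 A then 2 else 1).
Proof.
rewrite /pent_type /pent_rel /twist /=.
move: (d 0) (d 1) (d 2) (d 3) (d 4)%N => [] [] // [] // [] [] // _ _ _;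
  by case: A.
Qed.

Lemma eq_pent_type h h' t : (forall k, (k < 5)%N -> h k = h' k) ->
  pent_type h t = pent_type h' t.
Proof.
move=> eq_h; have eq_rel e : pent_rel h e = pent_rel h' e.
  apply: eq_has => al; apply: eq_in_all => k; rewrite mem_iota => lt_k.
  by rewrite eq_h.
by rewrite /pent_type !eq_rel.
Qed.

Lemma inord5_eq i j : (i < 5)%N -> (j < 5)%N ->
  (inord i == inord j :> 'I_5) = (i == j).
Proof. by move=> lt_i lt_j; rewrite -(inj_eq val_inj) /= !inordK. Qed.

Lemma Lam_proj_type (a : 'I_5 -> nat) (apos : forall i, (0 < a i)%N) A n1 n4
    (b : forall i, 'I_(a i)) :
  let s := neff a ord0 n1 (b ord0) + neff a (inord 3) n4 (b (inord 3)) in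
  proj_type (@Lam a (\sum_(i < 5) a i - 3)%N ord0 A n1 n4) b
    (inord (if (s != 0) (+) is_A3 A then 2 else 1)).
Proof.
move=> s; pose D := lam_twist apos ord0 n1 n4.
pose d k := pent_vertex b (inord k) \in D.
(* The value 0 of [neff] at the special vertex matches the exclusion of special vertices from
   [lam_twist]. *)
have neff_bit (i : 'I_5) m : (pent_vertex b i != svert apos i) && (m (b i : nat) != 0) =
    (neff a i m (b i) != 0).
  by rewrite svert_tag negbK /neff /=; case: ifP; rewrite ?eqxx.
have dE k : d k = (pent_vertex b (inord k) != svert apos (inord k)) &&
    (((inord k : 'I_5) == rcls ord0 0) && (n1 (b (inord k)) != 0) ||
     ((inord k : 'I_5) == rcls ord0 3) && (n4 (b (inord k)) != 0)).
  by rewrite /d inE.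
have {}dE k : (k < 5)%N -> d k = (pent_vertex b (inord k) != svert apos (inord k)) &&
    ((k == 0)%N && (n1 (b (inord k)) != 0) || (k == 3)%N && (n4 (b (inord k)) != 0)).
  by move=> lt_k; rewrite dE /rcls !add0n !modn_small // !inord5_eq.
have d0 : d 0%N = (neff a ord0 n1 (b ord0) != 0).
  have -> : (ord0 : 'I_5) = inord 0 by apply/val_inj; rewrite /= inordK.
  by rewrite dE //= -neff_bit orbF.
have d3 : d 3%N = (neff a (inord 3) n4 (b (inord 3)) != 0).
  by rewrite dE //= -neff_bit.
have dF k : (k < 5)%N -> k != 0%N -> k != 3%N -> ~~ d k.
  by move=> lt_k /negPf k0 /negPf k3; rewrite dE // k0 k3 andbF.
have -> : (s != 0) = d 0%N (+) d 3%N.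
  rewrite d0 d3 /s -[neff a ord0 _ _]natrF2_neq0 -[neff a (inord 3) _ _]natrF2_neq0.
  by do 2!case: (neff _ _ _ _ != 0).
apply: (proj_type_pent (Lam_gale apos ord0 A n1 n4)); first by case: ifP.
rewrite (eq_pent_type _ (h' := twist (lam_type 0 A) d)).
  by apply: pent_type_twist; apply: dF.
by move=> k lt_k; rewrite /pent /twisted /twist /= inordK.
Qed.

Theorem theorem8p3 (a : 'I_5 -> nat) (apos : forall i, (0 < a i)%N) :
  let N := (\sum_(i < 5) a i)%N in
  let n := (N - 3)%N in
  (* every choice of A, n1, n4 gives a small cover *)
  (forall (A : Achoice) (n1 n4 : nat -> 'F_2), nonsing (@Lam a n ord0 A n1 n4))
  (* every small cover is, up to rotation and basis change, such a Lambda *)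
  /\ (forall lam : vert a -> 'rV['F_2]_n, nonsing lam ->
        exists (r : 'I_5) (A : Achoice) (n1 n4 : nat -> 'F_2),
          dj (@Lam a n r A n1 n4) lam)
  (* types of the projections over the pentagons *)
  /\ (forall (A : Achoice) (n1 n4 : nat -> 'F_2) (b : forall i : 'I_5, 'I_(a i)),
        let s := neff a ord0 n1 (b ord0) + neff a (inord 3) n4 (b (inord 3)) in
        (((A = A3 /\ s = 0) \/ (A = A2 /\ s = 1)) ->
           proj_type (@Lam a n ord0 A n1 n4) b (inord 2))
        /\ (((A = A3 /\ s = 1) \/ (A = A2 /\ s = 0)) ->
           proj_type (@Lam a n ord0 A n1 n4) b (inord 1)))
  (* the number of DJ classes *)
  /\ num_dj_classes a n =
       (2 ^ (a ord0 + a (inord 3)).-1 + 2 ^ (a (inord 1) + a (inord 4)).-1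
        + 2 ^ (a (inord 2) + a ord0).-1 + 2 ^ (a (inord 3) + a (inord 1)).-1
        + 2 ^ (a (inord 4) + a (inord 2)).-1 - 5)%N.
Proof.
split; first by move=> A n1 n4; exact: Lam_nonsing.
split; first by move=> lam; exact: nonsing_dj_Lam.
split; last exact: num_dj_classesE.
move=> A n1 n4 b; have := Lam_proj_type apos A n1 n4 b => /=.
by set s := (_ + _ : 'F_2); move=> type_b; split=> -[[def_A def_s]|[def_A def_s]];
  move: type_b; rewrite def_A def_s.
Qed.
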